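(* Let $(X,\mu)\in\mathbf{P}'_{\mathbb R}$. Then there is a function $\mu'\le\mu$ such that $(X,\mu')\in\mathbf{P}'_{\mathbb R}$ and $\log_2\mu'$ can be estimated in polynomial time with respect to the input size for $x\in X$.
   Context: A machine is a BSS machine over $\mathbb R$ (real constants, exact arithmetic, branching on signs); $T_M(x)$ is its running time and $M(x)$ its output, output $>0$ meaning YES. A decision problem is a pair $(X,\mu)$ with $X\subseteq\mathbb R^\infty=\bigsqcup_k\mathbb R^k$ and $\mu:\mathbb R^\infty\to[1,\infty]$; for $x\in\mathbb R^n$, $\mathrm{Length}(x)=n$ and $\mathrm{Size}(x)=n(1+\log_2\mu(x))$. $\mathbf{P}'_{\mathbb R}$ is the class of $(X,\mu)$ for which there are a machine $M$ and a polynomial $p$ with (a) $T_M(x)<p(\mathrm{Size}(x))$ whenever $x\in X$ and $\mathrm{Size}(x)<\infty$; (b) whenever $T_M(x)<\infty$, $M(x)>0\iff x\in X$. A function $f$ can be estimated in polynomial time (with respect to some input size) if there is a machine which, given the input and $\epsilon>0$, produces an $\epsilon$-approximation of $f$ in time polynomial in the input size and $\log\epsilon^{-1}$. *)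

(* Defs.v *)
From HB Require Import structures.
From mathcomp Require Import all_boot all_order all_algebra.
From mathcomp Require Import all_classical all_reals.
From mathcomp Require Import ereal exp.

Set Implicit Arguments.
Unset Strict Implicit.
Unset Printing Implicit Defensive.

Import Order.TTheory GRing.Theory Num.Theory.
Local Open Scope classical_set_scope.
Local Open Scope ring_scope.

(* Uniform BSS machines over R, in the style of Blum, Cucker, Shub and Smale,
   "Complexity and Real Computation".

   A point of the disjoint union of the R^k, k >= 0, is a sequence [seq R].
   A state is a bi-infinite sequence [int -> R]; the textbook writes it
   (... s(-2) s(-1) . s(0) s(1) ...), the cells right of the dot being the
   nonnegative indices here. Reachable states have finite support, since inputs
   do and every node preserves this, so it is not imposed. *)
Definition state (R : Type) := int -> R.

(* [GRing.rterm] excludes inverses, so the terms below are polynomials with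
   coefficients in R (and integers), and a [rat_fun] is their quotient. *)
Record rat_fun (R : realType) := RatFun {
  rat_num : GRing.term R;
  rat_den : GRing.term R;
  rat_num_poly : GRing.rterm rat_num;
  rat_den_poly : GRing.rterm rat_den }.

(* [Compute fs q] applies the rational map R^m -> R^m with components [fs],
   m = size fs, to the cells 0, ..., m - 1, and goes to q.
   [Branch qy qn] goes to qy if the cell 0 is >= 0 and to qn if it is < 0. *)
Inductive instr (R : realType) (Q : Type) :=
| Compute of seq (rat_fun R) & Q
| Branch of Q & Q
| ShiftLeft of Q
| ShiftRight of Q
| Output.
Arguments ShiftLeft {R Q}.
Arguments ShiftRight {R Q}.
Arguments Branch {R Q}.
Arguments Output {R Q}.

(* [start] is the successor of the input node, which is kept implicit. *)
Record machine (R : realType) := Machine {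
  node : finType;
  start : node;
  prog : node -> instr R node }.

Section Machines.
Variable R : realType.
Implicit Types (M : machine R) (x : seq R) (s : state R) (mu : seq R -> \bar R).

(* (... 0 1 ... 1 . x_1 ... x_n 0 ...) with n ones, which give Length(x) in
   unary to the machine. *)
Definition input_state x : state R := fun z =>
  match z with
  | Posz k => nth 0 x k
  | Negz k => if (k < size x)%N then 1 else 0
  end.

(* [None] when a denominator vanishes. *)
Definition apply_rat (fs : seq (rat_fun R)) s : option (state R) :=
  let e := mkseq (fun k => s (Posz k)) (size fs) in
  if all (fun f => GRing.eval e (rat_den f) != 0) fs then
    let v := [seq GRing.eval e (rat_num f) / GRing.eval e (rat_den f) | f <- fs]
    in Some (fun z => match z with
                      | Posz k => nth (s z) v k
                      | Negz _ => s z
                      end)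
  else None.

Definition config M := (node M * state R)%type.

Definition step M (c : config M) : option (config M) :=
  match prog c.1 with
  | Compute fs q => omap (pair q) (apply_rat fs c.2)
  | Branch qy qn => Some (if 0 <= c.2 0 then qy else qn, c.2)
  | ShiftLeft q => Some (q, fun z => c.2 (z + 1))
  | ShiftRight q => Some (q, fun z => c.2 (z - 1))
  | Output => None
  end.

Definition config_at M x (t : nat) : option (config M) :=
  iter t (obind (@step M)) (Some (start M, input_state x)).

(* M on input x reaches an output node after t steps, with r in the cell 0. *)
Definition halts_with M x (t : nat) (r : R) : Prop :=
  exists c : config M,
    [/\ config_at M x t = Some c, prog c.1 = Output & c.2 0 = r].

(* T_M(x), equal to +oo when M does not reach an output node; a computation
   that stops at a vanishing denominator thus counts as nonterminating. *)
Definition run_time M x : \bar R :=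
  ereal_inf [set t%:R%:E | t in [set t : nat | exists r, halts_with M x t r]].

(* M(x), meaningful only when T_M(x) < +oo. *)
Definition run_output M x : R :=
  xget 0 [set r | exists t, halts_with M x t r].

Definition log2e (y : \bar R) : \bar R := (lne y * (ln 2)^-1%:E)%E.

(* In [\bar R], 0 * +oo = 0: the empty sequence has Size 0. *)
Definition Size mu x : \bar R := ((size x)%:R%:E * (1 + log2e (mu x)))%E.

(* (X, mu) belongs to P'_R *)
Definition in_P' (X : set (seq R)) mu : Prop :=
  exists (M : machine R) (p : {poly R}),
    (forall x, X x -> (Size mu x < +oo)%E ->
       (run_time M x < p.[fine (Size mu x)]%:E)%E) /\
    (forall x, (run_time M x < +oo)%E -> (0 < run_output M x <-> X x)).

(* The precision eps is given to the machine in front of x. The logarithm of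
   1/eps is truncated at 0, being negative for eps > 1. On inputs of infinite
   size the time bound is void and nothing is required. *)
Definition poly_time_estimable (f : seq R -> \bar R) (D : set (seq R))
    (sz : seq R -> \bar R) : Prop :=
  exists (M : machine R) (q : {poly {poly R}}),
    forall x, D x -> (sz x < +oo)%E -> forall eps : R, 0 < eps ->
      (run_time M (eps :: x)
         < q.[(fine (sz x))%:P].[Num.max 0 (ln eps^-1)]%:E)%E /\
      (`|(run_output M (eps :: x))%:E - f x| <= eps%:E)%E.

End Machines.

(* Main.v *)
(* Bound p(s) by A (1 + s)^d and put, for x in X of length n on which M halts
   after T steps, mu'(x) = 2^L with L the least natural number such that
   T < A (1 + n (2 + L))^d. Minimality gives mu' <= mu, and the inequality
   itself bounds T by a polynomial in n (1 + L) = Size(x), so M still witnesses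
   membership in P'_R. Everywhere else mu' = mu. As L is an integer it can be
   computed exactly, whatever the precision: a machine counts n, simulates M
   with a clock to find T, and then searches for L. On the input eps :: x a
   single shift to the right leaves precisely the input x of M with two spare
   cells inserted at the origin; they hold n and T during the simulation. *)

From HB Require Import structures.
Require Import Defs.
From mathcomp Require Import all_boot all_order all_algebra.
From mathcomp Require Import all_classical all_reals.
From mathcomp Require Import ereal exp.
From mathcomp Require Import lra zify.
Local Open Scope ring_scope.

Set Implicit Arguments.
Unset Strict Implicit.
Unset Printing Implicit Defensive.

Import Order.TTheory GRing.Theory Num.Theory.

(** * Neighbouring tape cells *)

Lemma Posz_add1 (k : nat) : Posz k + 1 = Posz k.+1.
Proof. by rewrite -PoszD addn1. Qed.

Lemma Negz_add1 (k : nat) : Negz k.+1 + 1 = Negz k.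
Proof. by rewrite !NegzE; lia. Qed.

Lemma Posz_sub1 (k : nat) : Posz k.+1 - 1 = Posz k.
Proof. by lia. Qed.

Lemma Negz_sub1 (k : nat) : Negz k - 1 = Negz k.+1.
Proof. by rewrite !NegzE; lia. Qed.

(** * Halting runs and reachability in bounded time *)

Section Runs.
Variable R : realType.
Implicit Types (M : machine R) (s : state R).

(** An output node has no successor, so the run is undefined at every later time. *)
Lemma halts_with_inj M x t1 t2 (r1 r2 : R) :
  halts_with M x t1 r1 -> halts_with M x t2 r2 -> t1 = t2 /\ r1 = r2.
Proof.
have stuck u v (c : config M) : config_at M x u = Some c ->
    prog c.1 = Output -> (u < v)%N -> config_at M x v = None.
  move=> cu outc ltuv; rewrite -(subnK ltuv) /config_at iterD iterS.
  rewrite -[iter u _ _]/(config_at M x u) cu /= /step outc.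
  by elim: (v - u.+1)%N => //= k ->.
move=> [c1 [h1 o1 <-]] [c2 [h2 o2 <-]].
have [lt12|lt21|eq12] := ltngtP t1 t2.
- by rewrite (stuck _ _ _ h1 o1 lt12) in h2.
- by rewrite (stuck _ _ _ h2 o2 lt21) in h1.
- by move: h2; rewrite -eq12 h1 => -[->].
Qed.

Lemma run_time_halts M x t (r : R) :
  halts_with M x t r -> run_time M x = t%:R%:E.
Proof.
move=> h; rewrite /run_time.
suff -> : [set t : nat | exists r, halts_with M x t r]%classic = [set t]%classic.
  by rewrite image_set1 ereal_inf1.
apply/seteqP; split=> [u [r' /halts_with_inj/(_ h)[]]//|_ ->].
by exists r.
Qed.

Lemma run_output_halts M x t (r : R) :
  halts_with M x t r -> run_output M x = r.
Proof.
move=> h; rewrite /run_output; case: xgetP => [_ -> [u /halts_with_inj/(_ h)[]]//|].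
by move=> /(_ r); case; exists t.
Qed.

Lemma run_time_fin M x :
  (run_time M x < +oo)%E -> exists t r, halts_with M x t r.
Proof.
move=> hfin; apply/not_existsP => noh; move: hfin.
rewrite /run_time (_ : [set t : nat | _]%classic = set0).
  by rewrite image_set0 ereal_inf0 ltxx.
by apply/seteqP; split=> // t [r h]; case: (noh t); exists r.
Qed.

(** Only an upper bound on the number of steps is kept, so that nodes of unequal cost obey one
    bound. *)
Definition reach M (c : config M) (k : nat) (c' : config M) : Prop :=
  exists2 t, (t <= k)%N & iter t (obind (@step R M)) (Some c) = Some c'.

Lemma reach0 M (c : config M) : reach c 0 c.
Proof. by exists 0%N. Qed.

Lemma reachS M (c c1 c2 : config M) k :
  step c = Some c1 -> reach c1 k c2 -> reach c k.+1 c2.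
Proof. by move=> e [t tk h]; exists t.+1 => //; rewrite iterSr /= e. Qed.

Lemma reach_trans M (c1 c2 c3 : config M) k1 k2 :
  reach c1 k1 c2 -> reach c2 k2 c3 -> reach c1 (k1 + k2) c3.
Proof.
move=> [t1 le1 h1] [t2 le2 h2]; exists (t2 + t1)%N; first by rewrite addnC leq_add.
by rewrite iterD h1.
Qed.

Lemma reach_le M (c c' : config M) k l :
  (k <= l)%N -> reach c k c' -> reach c l c'.
Proof. by move=> kl [t tk h]; exists t => //; apply: leq_trans tk kl. Qed.

(** * Writing to cells and reserving two of them *)

Definition put (v : seq R) s : state R := fun z =>
  match z with
  | Posz k => nth (s z) v k
  | Negz _ => s z
  end.

Lemma apply_rat_put (fs : seq (rat_fun R)) s :
  let e := mkseq (fun k => s (Posz k)) (size fs) in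
  all (fun f => GRing.eval e (rat_den f) != 0) fs ->
  apply_rat fs s =
  Some (put [seq GRing.eval e (rat_num f) / GRing.eval e (rat_den f) | f <- fs]
            s).
Proof. by move=> e den_neq0; rewrite /apply_rat -/e den_neq0. Qed.

(** The constant denominator is the source of the recurring [oner_neq0] and [divr1] below. *)
Definition poly_fun (t : GRing.term R) (rt : GRing.rterm t) : rat_fun R :=
  @RatFun R t (GRing.Const 1) rt isT.

(** Renaming the variables makes a map of [M] read its arguments behind the two registers. *)
Fixpoint term_shift (k : nat) (t : GRing.term R) : GRing.term R :=
  match t with
  | GRing.Var i => GRing.Var R (k + i)
  | GRing.Const a => GRing.Const a
  | GRing.NatConst n => GRing.NatConst R n
  | GRing.Add t1 t2 => GRing.Add (term_shift k t1) (term_shift k t2)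
  | GRing.Opp t1 => GRing.Opp (term_shift k t1)
  | GRing.NatMul t1 n => GRing.NatMul (term_shift k t1) n
  | GRing.Mul t1 t2 => GRing.Mul (term_shift k t1) (term_shift k t2)
  | GRing.Inv t1 => GRing.Inv (term_shift k t1)
  | GRing.Exp t1 n => GRing.Exp (term_shift k t1) n
  end.

Lemma rterm_shift k t : GRing.rterm t -> GRing.rterm (term_shift k t).
Proof.
by elim: t => //= t1 IH1 t2 IH2 /andP[r1 r2]; rewrite IH1 ?IH2.
Qed.

Lemma eval_shift (e1 e2 : seq R) t :
  GRing.eval (e1 ++ e2) (term_shift (size e1) t) = GRing.eval e2 t.
Proof.
elim: t => //= [i|t1 -> t2 -> //|t1 -> //|t1 -> //|t1 -> t2 -> //|t1 -> //|t1 -> //].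
by rewrite nth_cat ltnNge leq_addr /= addKn.
Qed.

Definition rat_shift k (f : rat_fun R) : rat_fun R :=
  RatFun (rterm_shift k (rat_num_poly f)) (rterm_shift k (rat_den_poly f)).

(* [r0] and [r1] are inserted at the cells 0 and 1 of the tape [c], whose
   nonnegative part moves two cells to the right. *)
Definition regs (r0 r1 : R) (c : state R) : state R := fun z =>
  match z with
  | Posz 0 => r0
  | Posz 1 => r1
  | Posz k.+2 => c (Posz k)
  | Negz k => c (Negz k)
  end.

End Runs.

(** * The estimating machine *)

Inductive stage :=
| Widen | Clear | CountMove | CountLook | CountTest | CountInc | CountStop
| CountBack | Rewind | RewindTest | RewindCarry | RewindMove | RewindStop
| FitTest | FitInc | FitDone | Stop.

Definition stages : seq stage :=
  [:: Widen; Clear; CountMove; CountLook; CountTest; CountInc; CountStop;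
      CountBack; Rewind; RewindTest; RewindCarry; RewindMove; RewindStop;
      FitTest; FitInc; FitDone; Stop].

Definition stage_rank (s : stage) : nat :=
  match s with
  | Widen => 0 | Clear => 1 | CountMove => 2 | CountLook => 3 | CountTest => 4
  | CountInc => 5 | CountStop => 6 | CountBack => 7 | Rewind => 8
  | RewindTest => 9 | RewindCarry => 10 | RewindMove => 11 | RewindStop => 12
  | FitTest => 13 | FitInc => 14 | FitDone => 15 | Stop => 16
  end.

Lemma stage_rankK : cancel stage_rank (nth Stop stages).
Proof. by case. Qed.

HB.instance Definition _ := Countable.copy stage (can_type stage_rankK).

Lemma stages_enum : Finite.axiom stages.
Proof. by case. Qed.

HB.instance Definition _ := isFinite.Build stage stages_enum.

Section Estimator.
Variables (R : realType) (M : machine R) (A : R) (d : nat).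

(** The bound [A * (1 + s) ^+ d] at the size [s = n * (1 + j)] of an input of length [n] where [mu]
    has binary logarithm [j]. *)
Definition fit_bound (n j : R) : R := A * (1 + n * (1 + j)) ^+ d.

(* [inl (q, None)] simulates the node q of M; the tag [Some _] marks the
   intermediate nodes of that simulation. *)
Definition est_node : finType :=
  (node M * option (option bool) + stage)%type.

Local Notation sim q := (inl (q, None) : est_node).
Local Notation mid q := (inl (q, Some None) : est_node).
Local Notation cell i := (GRing.Var R i).
Local Notation poly t := (@poly_fun R t%T isT).

(** During the simulation the registers stand at the cells 0 and 1, so the cell 0 of [M] is the cell
    2. A branch of [M] swaps it into the cell 0, and the boolean tag remembers the outcome until the
    swap is undone. At a shift the registers trade places with a cell of [M] so as to stay under the
    head. The counting and rewinding stages carry them over the unary marks and back in the same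
    way. In the search the cells 0 to 3 hold the tested difference, n, T and the candidate L. *)
Definition est_prog (v : est_node) : instr R est_node :=
  match v with
  | inl (q, k) =>
    match prog q, k with
    | Compute fs q', _ =>
        Compute (poly (cell 0) :: poly (cell 1 + 1) :: map (rat_shift 2) fs) (sim q')
    | Branch _ _, None =>
        Compute [:: poly (cell 2); poly (cell 1 + 1); poly (cell 0)] (mid q)
    | Branch _ _, Some None =>
        Branch (inl (q, Some (Some true))) (inl (q, Some (Some false)))
    | Branch qy qn, Some (Some b) =>
        Compute [:: poly (cell 2); poly (cell 1); poly (cell 0)]
          (sim (if b then qy else qn))
    | ShiftLeft _, None =>
        Compute [:: poly (cell 2); poly (cell 0); poly (cell 1 + 1)] (mid q)
    | ShiftLeft q', Some _ => ShiftLeft (sim q')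
    | ShiftRight _, None => ShiftRight (mid q)
    | ShiftRight q', Some _ =>
        Compute [:: poly (cell 1); poly (cell 2 + 1); poly (cell 0)] (sim q')
    | Output, _ =>
        Compute [:: poly (cell 1 - GRing.Const A * (1 + cell 0 * (1 + 1)) ^+ d);
                    poly (cell 0); poly (cell 1); poly 0] (inr FitTest)
    end
  | inr Widen => ShiftRight (inr Clear)
  | inr Clear => Compute [:: poly 0; poly 0] (inr CountMove)
  | inr CountMove => ShiftRight (inr CountLook)
  | inr CountLook => Compute [:: poly (cell 0 - 1)] (inr CountTest)
  | inr CountTest => Branch (inr CountInc) (inr CountStop)
  | inr CountInc =>
      Compute [:: poly (cell 1 + 1); poly (cell 2); poly 1] (inr CountMove)
  | inr CountStop =>
      Compute [:: poly 0; poly (cell 1); poly (cell 1)] (inr CountBack)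
  | inr CountBack => ShiftLeft (inr Rewind)
  | inr Rewind => Compute [:: poly (cell 1 - 1); poly (cell 0)] (inr RewindTest)
  | inr RewindTest => Branch (inr RewindCarry) (inr RewindStop)
  | inr RewindCarry =>
      Compute [:: poly (cell 2); poly (cell 1); poly (cell 0)] (inr RewindMove)
  | inr RewindMove => ShiftLeft (inr Rewind)
  | inr RewindStop => Compute [:: poly (cell 1); poly 0] (sim (start M))
  | inr FitTest => Branch (inr FitInc) (inr FitDone)
  | inr FitInc =>
      Compute [:: poly (cell 2 - GRing.Const A *
                          (1 + cell 1 * (1 + (cell 3 + 1 + 1))) ^+ d);
                  poly (cell 1); poly (cell 2); poly (cell 3 + 1)] (inr FitTest)
  | inr FitDone =>
      Compute [:: poly (cell 3); poly (cell 1); poly (cell 2); poly (cell 3)]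
        (inr Stop)
  | inr Stop => Output
  end.

Definition estimator : machine R := @Machine R est_node (inr Widen) est_prog.

(** * Correctness and running time of the estimator *)

Implicit Types (c s : state R).

Lemma put_put v w s : (size w <= size v)%N -> put v (put w s) = put v s.
Proof.
move=> le_wv; apply/funext => -[k|k] //=.
have [lt_kv|le_vk] := ltnP k (size v); first exact: set_nth_default.
by rewrite !(nth_default _ le_vk) nth_default // (leq_trans le_wv).
Qed.

Lemma put_regs a b e n T c :
  put [:: a; b; e] (regs n T c) = regs a b (put [:: e] c).
Proof. by apply/funext => -[[|[|[|k]]]|k]. Qed.

Lemma put_regs2 a b n T c : put [:: a; b] (regs n T c) = regs a b c.
Proof. by apply/funext => -[[|[|k]]|k] //=; rewrite nth_nil. Qed.

Lemma put_cell0 c : put [:: c 0] c = c.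
Proof. by apply/funext => -[[|k]|k] //=; rewrite nth_nil. Qed.

Lemma shiftl_put n T c (r0 r1 : R) :
  (fun z => put [:: c 0; r0; r1] (regs n T c) (z + 1)) =
  regs r0 r1 (fun z => c (z + 1)).
Proof.
apply/funext => -[[|[|k]]|[|k]] //.
by rewrite [RHS]/regs !Posz_add1 /= nth_nil.
Qed.

Lemma put_shiftr n T c (r0 r1 : R) :
  put [:: r0; r1; c (-1)] (fun z => regs n T c (z - 1)) =
  regs r0 r1 (fun z => c (z - 1)).
Proof.
by apply/funext => -[[|[|[|k]]]|k] //=; rewrite nth_nil !Posz_sub1.
Qed.

(** The environment of the estimator is that of [M] preceded by the two registers, so shifted terms
    keep their values and the same denominators vanish. *)
Lemma apply_rat_sim (fs : seq (rat_fun R)) n T c :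
  apply_rat (poly (cell 0) :: poly (cell 1 + 1) :: map (rat_shift 2) fs)
    (regs n T c) =
  omap (regs n (T + 1)) (apply_rat fs c).
Proof.
rewrite /apply_rat /= size_map.
set e := mkseq (fun k => c k) _; set e' := mkseq _ _.
have -> : e' = [:: n; T] ++ e.
  by rewrite /e' /mkseq /= (iotaDl 2 0) -map_comp.
have evE t : GRing.eval ([:: n; T] ++ e) (term_shift 2 t) = GRing.eval e t.
  exact: (eval_shift [:: n; T]).
rewrite oner_neq0 /= all_map.
rewrite (@eq_all _ _ (fun f => GRing.eval e (rat_den f) != 0)); last first.
  by move=> f; rewrite /= -evE.
case: ifP => // _; congr Some; apply/funext => -[k|k] //=.
rewrite !divr1 -map_comp.
rewrite (eq_map (g := fun f => GRing.eval e (rat_num f) / GRing.eval e (rat_den f))).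
  by case: k => [|[|k]].
by move=> f; rewrite /= -!evE.
Qed.

(** A branch costs three steps, a shift two and a computation one; the clock advances by one in
    every case. *)
Lemma sim_step q c q' c' n T :
  step (q, c) = Some (q', c') ->
  @reach R estimator (sim q, regs n T c) 3 (sim q', regs n (T + 1) c').
Proof.
rewrite {1}/step /=; case Eq: (prog q) => [fs q1|qy qn|q1|q1|] //=.
- case Ea: (apply_rat fs c) => [c1|] //= [<- <-].
  apply: (reach_le (k := 1)) => //; apply: reachS; last exact: reach0.
  by rewrite /step /= Eq apply_rat_sim Ea.
- move=> [<- <-].
  apply: reachS; first by rewrite /step /= Eq apply_rat_put /= ?oner_neq0.
  rewrite !divr1; apply: reachS; first by rewrite /step /= Eq.
  apply: reachS; last exact: reach0.
  rewrite /step /=; case: ifP => _ /=;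
    by rewrite Eq apply_rat_put /= ?oner_neq0 //= !divr1 put_put // put_regs
               put_cell0.
- move=> [<- <-]; apply: (reach_le (k := 2)) => //.
  apply: reachS; first by rewrite /step /= Eq apply_rat_put /= ?oner_neq0.
  rewrite !divr1; apply: reachS; last exact: reach0.
  by rewrite /step /= Eq shiftl_put.
- move=> [<- <-]; apply: (reach_le (k := 2)) => //.
  apply: reachS; first by rewrite /step /= Eq.
  apply: reachS; last exact: reach0.
  rewrite /step /= Eq apply_rat_put /= ?oner_neq0 //= !divr1.
  by rewrite -(put_shiftr n T).
Qed.

Lemma sim_reach q c q' c' n (T t : nat) :
  iter t (obind (@step R M)) (Some (q, c)) = Some (q', c') ->
  @reach R estimator (sim q, regs n T%:R c) (3 * t)
    (sim q', regs n (T + t)%:R c').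
Proof.
elim: t q' c' => [|t IH] q' c' /=.
  by move=> [<- <-]; rewrite addn0; exact: reach0.
case Et: (iter t _ _) => [[q1 c1]|] //= h.
rewrite mulnSr (addnS T) -natr1; apply: reach_trans (IH _ _ Et) _.
exact: sim_step.
Qed.

(** The sign of the cell 0 tells whether the candidate is still too small. A rejected candidate
    costs a test and an update, the accepted one a test and its copy to the cell 0. *)
Lemma fit_reach (n T L L' : nat) s :
  (L <= L')%N ->
  (forall j, (L <= j < L')%N -> fit_bound n%:R j.+1%:R <= T%:R) ->
  T%:R < fit_bound n%:R L'.+1%:R ->
  exists2 s', @reach R estimator
    (inr FitTest,
     put [:: T%:R - fit_bound n%:R L.+1%:R; n%:R; T%:R; L%:R] s)
    (2 * (L' - L) + 2) (inr Stop, s') & s' 0 = L'%:R.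
Proof.
move=> le_LL' low high; have [k def_k] : exists k, (L' - L)%N = k by eexists.
rewrite def_k; elim: k => [|k IH] in L le_LL' low def_k *.
  have -> : L = L' by lia.
  exists (put [:: L'%:R; n%:R; T%:R; L'%:R] s) => //.
  apply: reachS.
    rewrite /step /= subr_ge0 leNgt high; reflexivity.
  apply: reachS; last exact: reach0.
  by rewrite /step /= apply_rat_put /= ?oner_neq0 //= !divr1 put_put.
have lt_LL' : (L < L')%N by lia.
case: (IH L.+1); [by []|by move=> j ?; apply: low; lia|by lia|].
move=> s' hs' s'0; exists s' => //.
have -> : (2 * k.+1 + 2 = (2 * k + 2).+2)%N by lia.
apply: reachS.
  rewrite /step /= subr_ge0 low ?leqnn //; reflexivity.
apply: reachS hs'.
rewrite /step /= apply_rat_put /= ?oner_neq0 //= !divr1 put_put //.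
by rewrite /fit_bound -!natr1 add0r.
Qed.

(** Counting has to look one cell past the last mark; this undoes that move. *)
Lemma shiftl_put_shiftr n T c (r0 r1 : R) :
  (fun z => put [:: c (-1); r0; r1] (fun z => regs n T c (z - 1)) (z + 1)) =
  regs r0 r1 c.
Proof.
apply/funext => -[[|[|k]]|[|k]] //; last first.
  by rewrite Negz_add1 [LHS]/(regs n T c (Negz k - 1)) Negz_sub1.
by rewrite Posz_add1 /put Posz_sub1 nth_default.
Qed.

(** The shift brings one of the [size x + 1] marks to the cell 0 and [eps] to the cell 1; both get
    erased. *)
Lemma clear_input (eps : R) x :
  put [:: 0; 0] (fun z => input_state (eps :: x) (z - 1)) =
  regs 0 0 (input_state x).
Proof.
apply/funext => -[[|[|k]]|k] //.
  by rewrite /put Posz_sub1 nth_default.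
by rewrite /put Negz_sub1.
Qed.

(** Loop invariant after [j] marks, with [k] to come. Each mark costs four steps and the end five;
    there the second register receives the length too, as the distance to travel back. *)
Lemma count_reach x (k j : nat) :
  (j + k = size x)%N ->
  @reach R estimator
    (inr CountMove, regs j%:R 0 (fun z => input_state x (z - j%:Z))) (4 * k + 5)
    (inr Rewind, regs (size x)%:R (size x)%:R
                   (fun z => input_state x (z - (size x)%:Z))).
Proof.
elim: k j => [|k IH] j def_n.
  have -> : j = size x by rewrite -def_n addn0.
  set n := size x; set c := fun z => _.
  (* The marks end at [Negz (n - 1)], and the cell looked at is [Negz n]. *)
  have c0 : c (-1) = 0.
    by rewrite /c (_ : -1 - n%:Z = Negz n) ?NegzE /= -?NegzE /= ?ltnn //; lia.
  apply: reachS; first by [].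
  apply: reachS; first by rewrite /step /= apply_rat_put /= ?oner_neq0.
  rewrite !divr1; apply: reachS.
    by rewrite /step /= c0 sub0r oppr_ge0 ler10.
  apply: reachS; first by rewrite /step /= apply_rat_put /= ?oner_neq0.
  apply: reachS; last exact: reach0.
  rewrite /step /= !divr1 put_put //.
  by rewrite -(shiftl_put_shiftr n%:R 0 c n%:R n%:R) c0.
set c := fun z => _.
have c0 : c (-1) = 1.
  rewrite /c (_ : -1 - j%:Z = Negz j) /=; last by rewrite NegzE; lia.
  by rewrite ifT //; lia.
have -> : (4 * k.+1 + 5 = (4 * k + 5).+4)%N by lia.
apply: reachS; first by [].
apply: reachS; first by rewrite /step /= apply_rat_put /= ?oner_neq0.
rewrite !divr1; apply: reachS.
  by rewrite /step /= c0 subrr lexx.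
apply: reachS; first by rewrite /step /= apply_rat_put /= ?oner_neq0.
have := put_shiftr j%:R 0 c (j%:R + 1) 0.
rewrite c0 natr1 !divr1 put_put // => ->.
have -> : (fun z => c (z - 1)) = (fun z => input_state x (z - j.+1%:Z)).
  by apply/funext => z; rewrite /c; congr input_state; lia.
by apply: IH; lia.
Qed.

(** The second register counts the cells left to go back. It is decremented before the test, so the
    loop ends at -1; it is then reset to 0 and becomes the clock. *)
Lemma rewind_reach n c (j : nat) :
  @reach R estimator (inr Rewind, regs n j%:R (fun z => c (z - j%:Z)))
    (4 * j + 3) (sim (start M), regs n 0 c).
Proof.
elim: j => [|j IH].
  apply: reachS; first by rewrite /step /= apply_rat_put /= ?oner_neq0.
  rewrite !divr1 sub0r; apply: reachS; first by rewrite /step /= oppr_ge0 ler10.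
  apply: reachS; first by rewrite /step /= apply_rat_put /= ?oner_neq0.
  rewrite !divr1 !put_regs2 (_ : (fun z => _) = c); first exact: reach0.
  by apply/funext => z; rewrite subr0.
set d' := fun z => _.
have -> : (4 * j.+1 + 3 = (4 * j + 3).+4)%N by lia.
apply: reachS; first by rewrite /step /= apply_rat_put /= ?oner_neq0.
rewrite !divr1 put_regs2 -natr1 addrK.
apply: reachS; first by rewrite /step /= ler0n.
apply: reachS; first by rewrite /step /= apply_rat_put /= ?oner_neq0.
apply: reachS; first by [].
rewrite !divr1 shiftl_put.
have -> : (fun z => d' (z + 1)) = (fun z => c (z - j%:Z)).
  by apply/funext => z; rewrite /d'; congr c; lia.
exact: IH.
Qed.

Lemma estimator_halts (eps r : R) x (T L : nat) :
  halts_with M x T r ->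
  (forall j, (j < L)%N -> fit_bound (size x)%:R j.+1%:R <= T%:R) ->
  T%:R < fit_bound (size x)%:R L.+1%:R ->
  exists2 t, (t <= 8 * size x + 3 * T + 2 * L + 13)%N &
             halts_with estimator (eps :: x) t L%:R.
Proof.
move=> [[q c] [/= hT outq _]] low high.
set n := size x in low high *.
have low0 j : (0 <= j < L)%N -> fit_bound n%:R j.+1%:R <= T%:R.
  by move=> /andP[_]; apply: low.
have [s' hfit s'0] := fit_reach (regs n%:R T%:R c) (leq0n L) low0 high.
suff [t le_t ht] : @reach R estimator (inr Widen, input_state (eps :: x))
    (8 * n + 3 * T + 2 * L + 13) (inr Stop, s').
  by exists t => //; exists (inr Stop, s').
(* In order of execution: two steps to widen and clear, counting, rewinding, the simulation, one
   step at the output node of [M], and the search. The constants are 2 + 5 + 3 + 1 + 2. *)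
have -> : (8 * n + 3 * T + 2 * L + 13 =
   ((4 * n + 5) + ((4 * n + 3) + (3 * T + (2 * (L - 0) + 2).+1))).+2)%N by lia.
apply: reachS; first by [].
apply: reachS; first by rewrite /step /= apply_rat_put /= ?oner_neq0.
rewrite !divr1 clear_input.
have /count_reach : (0 + n = size x)%N by [].
rewrite (_ : (fun z => _) = input_state x); last by apply/funext => z; rewrite subr0.
move=> /reach_trans; apply.
apply: reach_trans (rewind_reach _ _ _) _.
have /(sim_reach n%:R 0) /reach_trans := hT; apply.
apply: reachS hfit.
rewrite /step /= outq apply_rat_put /= ?oner_neq0 //= !divr1 /fit_bound.
by rewrite mulr1n.
Qed.

End Estimator.

(** * Polynomial bounds and the least fitting level *)

Lemma horner_le_power (R : realType) (p : {poly R}) :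
  exists2 A : R, 1 <= A &
    exists2 d, (0 < d)%N & forall s, 0 <= s -> p.[s] <= A * (1 + s) ^+ d.
Proof.
(* The added 1 gives [1 <= A], and the successor in the exponent gives [0 < d] even for [p = 0]. *)
exists (1 + \sum_(i < size p) `|p`_i|); first by rewrite lerDl sumr_ge0.
exists (size p).+1 => // s s0.
have s1 : 1 <= 1 + s by rewrite lerDl.
rewrite mulrDl -[leLHS]add0r lerD //.
  by rewrite mul1r exprn_ge0 // (le_trans ler01).
rewrite horner_coef mulr_suml ler_sum // => i _.
rewrite (le_trans (ler_norm _)) // normrM ler_wpM2l // ger0_norm ?exprn_ge0 //.
apply: (@le_trans _ _ ((1 + s) ^+ i)).
  by rewrite lerXn2r ?nnegrE ?addr_ge0 // lerDr.
by rewrite ler_weXn2l // ltnW // ltnS ltnW.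
Qed.

Lemma fit_bound_le (R : realType) (A : R) d (n j k : R) :
  0 <= A -> 0 <= n -> 0 <= j -> j <= k -> fit_bound A d n j <= fit_bound A d n k.
Proof.
move=> A0 n0 j0 jk; rewrite ler_wpM2l //; apply: lerXn2r; rewrite ?nnegrE.
- by rewrite addr_ge0 // mulr_ge0 // addr_ge0.
- by rewrite addr_ge0 // mulr_ge0 // addr_ge0 // (le_trans j0).
- by rewrite lerD2l ler_wpM2l // lerD2l.
Qed.

(** For [n = 0] the bound is [A] at every level, whence the hypothesis on [T]; otherwise it grows at
    least linearly with the level. *)
Lemma least_fit (R : realType) (A : R) d n T : 1 <= A -> (0 < d)%N ->
  (n = 0%N -> T%:R < A) ->
  exists L : nat, [/\ n = 0%N -> L = 0%N,
    forall j, (j < L)%N -> fit_bound A d n%:R j.+1%:R <= T%:R &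
    T%:R < fit_bound A d n%:R L.+1%:R].
Proof.
move=> A1 d0 T0; case: (posnP n) => [n0|n0].
  exists 0%N; split => //; rewrite n0 /fit_bound mul0r addr0 expr1n mulr1.
  exact: T0.
(* Level [T] fits: as [1 <= A] and [0 < d], the bound is at least the base of its power, which
   exceeds [T]. *)
have fitT : T%:R < fit_bound A d n%:R T.+1%:R.
  have n1 : 1 <= n%:R :> R by rewrite ler1n.
  have T_lt : T%:R < 1 + n%:R * (1 + T.+1%:R) :> R.
    rewrite -[_ < _]/(T%:R < 1%:R + n%:R * (1%:R + T.+1%:R)).
    by rewrite -natrD -natrM -natrD ltr_nat; nia.
  apply: (lt_le_trans T_lt).
  have b1 : 1 <= 1 + n%:R * (1 + T.+1%:R) :> R by rewrite lerDl mulr_ge0 ?addr_ge0.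
  apply: (le_trans _ (ler_peMl _ A1)); last by rewrite exprn_ge0 // (le_trans _ b1).
  exact: ler_eXnr.
have exL : exists L, T%:R < fit_bound A d n%:R L.+1%:R by exists T.
exists (ex_minn exL); case: ex_minnP => L fitL minL; split=> //.
  by move=> n_eq0; rewrite n_eq0 in n0.
move=> j ltj; rewrite leNgt; apply/negP => /minL.
by rewrite leqNgt ltj.
Qed.

Lemma ln2_gt0 (R : realType) : 0 < ln 2 :> R.
Proof. by rewrite ln_gt0 // ltr1n. Qed.

Lemma log2e_fin (R : realType) (r : R) : 1 <= r -> log2e r%:E = (ln r / ln 2)%:E.
Proof. by move=> r1; rewrite /log2e lne_EFin // (lt_le_trans ltr01). Qed.

Lemma log2e_pow (R : realType) L : log2e (2 ^+ L : R)%:E = L%:R%:E.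
Proof.
rewrite log2e_fin ?exprn_ege1 ?ler1n // lnXn // -(mulr_natl (ln 2)) mulfK //.
by rewrite gt_eqF // ln2_gt0.
Qed.

Lemma Size_pow (R : realType) (mu : seq R -> \bar R) x L :
  mu x = (2 ^+ L)%:E -> Size mu x = ((size x)%:R * (1 + L%:R))%:E.
Proof. by move=> e; rewrite /Size e log2e_pow. Qed.

(** * The new function at a single point *)

Section Level.
Variables (R : realType) (X : set (seq R)) (mu : seq R -> \bar R).
Variables (M : machine R) (p : {poly R}) (A : R) (d : nat).
Hypothesis mu_ge1 : forall x, (1 <= mu x)%E.
Hypothesis timeM : forall x, X x -> (Size mu x < +oo)%E ->
  (run_time M x < p.[fine (Size mu x)]%:E)%E.
Hypotheses (A_ge1 : 1 <= A) (d_gt0 : (0 < d)%N).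
Hypothesis p_le : forall s, 0 <= s -> p.[s] <= A * (1 + s) ^+ d.

(** Assuming the value of [Size mu x], not that of the logarithm, also covers the empty sequence, of
    size 0 even if [mu x] is infinite. *)
Lemma halting_time_lt x t r (ell : R) : X x -> halts_with M x t r -> 0 <= ell ->
  Size mu x = ((size x)%:R * (1 + ell))%:E -> t%:R < fit_bound A d (size x)%:R ell.
Proof.
move=> Xx h ell0 sz; have := timeM Xx; rewrite sz (run_time_halts h) ltry.
move=> /(_ isT); rewrite lte_fin => /lt_le_trans; apply; apply: p_le.
by rewrite mulr_ge0 ?addr_ge0.
Qed.

(** The pointwise form of mu', ready for the axiom of choice. If [M] does not halt at a point of
    [X], the time bound forces an infinite size there, so the last clause is void for [m = mu x]. *)
Lemma level_exists x : exists m : \bar R,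
  [/\ (1 <= m)%E, (m <= mu x)%E &
    X x -> ((size x)%:R%:E * (1 + log2e m) < +oo)%E ->
    exists T L r, [/\ halts_with M x T r, m = (2 ^+ L)%:E,
      size x = 0%N -> L = 0%N,
      forall j, (j < L)%N -> fit_bound A d (size x)%:R j.+1%:R <= T%:R &
      T%:R < fit_bound A d (size x)%:R L.+1%:R]].
Proof.
have [Xx|nXx] := pselect (X x); last by exists (mu x); split.
have [[T [r h]]|noh] := pselect (exists T r, halts_with M x T r); last first.
  exists (mu x); split=> // _ szfin; exfalso; apply: noh.
  by apply: run_time_fin; apply: (lt_trans (timeM Xx szfin)); exact: ltry.
have A0 : 0 <= A by rewrite (le_trans ler01).
have T0 : size x = 0%N -> T%:R < A.
  move=> n0; have := halting_time_lt Xx h (lexx 0).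
  by rewrite /Size n0 mul0e mul0r /fit_bound mul0r addr0 expr1n mulr1; exact.
have [L [L0 low high]] := least_fit A_ge1 d_gt0 T0.
exists (2 ^+ L)%:E; split.
- by rewrite lee_fin exprn_ege1 // ler1n.
(* At a level [L.+1], if [mu x] were smaller than [2 ^+ L.+1], then [M] would halt within the bound
   for [L.+1], which [low] says it does not. *)
- case: L => [|L] in L0 low high *; first by rewrite expr0.
  move: (mu_ge1 x); case mux: (mu x) => [u| |] //; rewrite ?leey // !lee_fin => u1.
  have lnu : 0 <= ln u / ln 2 
    by apply: divr_ge0; [exact: ln_ge0 | exact/ltW/ln2_gt0].
  have u0 : 0 < u by rewrite (lt_le_trans ltr01).
  rewrite -ler_ln ?posrE ?exprn_gt0 // lnXn // -(mulr_natl (ln 2)).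
  rewrite -ler_pdivlMr ?ln2_gt0 //.
  rewrite leNgt; apply/negP => /ltW uL.
  have := halting_time_lt Xx h lnu; rewrite /Size mux log2e_fin // => /(_ erefl).
  rewrite ltNge (le_trans _ (low L _)) //.
  exact: fit_bound_le.
- by move=> _ _; exists T, L, r.
Qed.

End Level.

Theorem theorem3p13 (R : realType) (X : set (seq R)) (mu : seq R -> \bar R)
    (mu_ge1 : forall x, (1 <= mu x)%E) (hP : in_P' X mu) :
  exists mu' : seq R -> \bar R,
    [/\ forall x, (1 <= mu' x)%E,
        forall x, (mu' x <= mu x)%E,
        in_P' X mu' &
        poly_time_estimable (fun x => log2e (mu' x)) X (Size mu')].
Proof.
case: hP => M [p [timeM outM]].
have [A A1 [d d0 p_le]] := horner_le_power p.
have [mu' mu'P] := choice (level_exists mu_ge1 timeM A1 d0 p_le).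
have A0 : 0 <= A by rewrite (le_trans ler01).
pose P : {poly R} := A%:P * (1 + 2%:R *: 'X) ^+ d.
have PE s : P.[s] = A * (1 + 2 * s) ^+ d by rewrite /P !hornerE.
(* For n = 0 both sides are A, and for n >= 1 the bound n(2 + L) is at most
   twice the size n(1 + L). *)
have fitP n L : fit_bound A d n%:R L.+1%:R <= P.[n%:R * (1 + L%:R)].
  rewrite PE ler_wpM2l // lerXn2r ?nnegrE ?addr_ge0 ?mulr_ge0 ?addr_ge0 //.
  rewrite lerD2l mulrCA ler_wpM2l // -natr1.
  by have := ler0n R L; lra.
exists mu'; split; [by move=> x; case: (mu'P x)|by move=> x; case: (mu'P x)| |].
- exists M, P; split=> // x Xx szx.
  have [_ _ /(_ Xx szx)[T [L [r [h muL _ _ high]]]]] := mu'P x.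
  by rewrite (Size_pow muL) (run_time_halts h) lte_fin /= (lt_le_trans high).
(* From [8 n + 3 T + 2 L + 13], where [n] and [L] are at most the size [s] and [T < P.[s]]. *)
- pose Q : {poly R} := 10%:R *: 'X + 3%:R *: P + 14%:P.
  (* The coefficients are constant in the logarithm of 1/eps, the output being exact. *)
  exists (estimator M A d), (map_poly polyC Q) => x Xx szx eps eps0.
  have [_ _ /(_ Xx szx)[T [L [r [h muL L0 low high]]]]] := mu'P x.
  have [t le_t ht] := estimator_halts eps h low high.
  rewrite (Size_pow muL) (run_time_halts ht) (run_output_halts ht) muL log2e_pow.
  split; last by rewrite -EFinB subrr abse0 lee_fin ltW.
  rewrite horner_map hornerC lte_fin /=.
  have := fitP (size x) L; set s := _ * _ => le_s.
  have s_ge_n : (size x)%:R <= s by rewrite ler_peMr // lerDl.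
  (* The size vanishes at length 0, so this needs [L = 0] there. *)
  have s_ge_L : L%:R <= s.
    have [n0|n0] := posnP (size x); first by rewrite L0 // mulr_ge0 ?addr_ge0.
    apply: (@le_trans _ _ (1 + L%:R)); first by rewrite lerDr.
    by rewrite ler_peMl ?addr_ge0 ?ler1n.
  have : t%:R <= 8 * (size x)%:R + 3 * T%:R + 2 * L%:R + 13 :> R.
    by rewrite -!natrM -!natrD ler_nat.
  by rewrite !(hornerD, hornerZ, hornerX, hornerC); lra.
Qed.
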